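(* Let $n,k,d$ be integers with $1\le k<d\le n-1$ and put $s=d-k+1$. There is a constant $c_s$ depending only on $s$ (not on $n$, $k$, $d$) such that for every prime power $q\ge c_s n$ there exists an $(n,k,\ell)$ MSR code over $\mathbb{F}_q$ with repair degree $d$ that has the optimal access property and whose sub-packetization is $\ell=s^{\lceil n/s\rceil}$.
   Context: An $(n,k,\ell)$ array code over the finite field $\mathbb{F}_q$ is an $\mathbb{F}_q$-linear subspace $\mathcal{C}\subseteq(\mathbb{F}_q^{\ell})^n$ of $\mathbb{F}_q$-dimension $k\ell$; codewords are written $(C_0,\dots,C_{n-1})$ with each node $C_i\in\mathbb{F}_q^\ell$, and $\ell$ is called the sub-packetization. It is an MDS array code if any $k$ of the $n$ nodes of a codeword determine the whole codeword. Let $k+1\le d\le n-1$ and $s=d-k+1$, with $s\mid \ell$. An $(n,k,\ell)$ MDS array code is an MSR (minimum storage regenerating) code with repair degree $d$ if for every $i\in\{0,\dots,n-1\}$ and every set $\mathcal{H}\subseteq\{0,\dots,n-1\}\setminus\{i\}$ with $|\mathcal{H}|=d$ there are functions $f_j:\mathbb{F}_q^{\ell}\to\mathbb{F}_q^{\ell/s}$ ($j\in\mathcal{H}$, depending on $i$ and $\mathcal{H}$) such that, for every codeword, $C_i$ is determined by $(f_j(C_j))_{j\in\mathcal{H}}$. (Downloading $\ell/s$ symbols from each of the $d$ helper nodes is the minimum possible repair bandwidth.) The MSR code has the optimal access property if the amount of data accessed equals the minimum repair bandwidth, i.e. the functions $f_j$ can be chosen so that each $f_j(C_j)$ consists of $\ell/s$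 of the coordinates of the vector $C_j$. *)

(* Defs.v *)
From HB Require Import structures.
From mathcomp Require Import all_boot all_order all_algebra.

Set Implicit Arguments.
Unset Strict Implicit.
Unset Printing Implicit Defensive.

Import GRing.Theory.

(* Words of (F^l)^n: x i : 'rV[F]_l is the node with index i. A code is an
   F-linear subspace of this space. *)
Notation array_word F n l := {ffun 'I_n -> 'rV[F]_l}.
Notation array_code F n l := {vspace array_word F n l}.

(* [ceil_div n s] is the ceiling of n / s, for s > 0. *)
Definition ceil_div (n s : nat) : nat := (n + s.-1) %/ s.

Lemma ceil_div_leq (n s m : nat) :
  0 < s -> (ceil_div n s <= m) = (n <= m * s).
Proof.
case: s => // s _; rewrite /ceil_div /= -ltnS ltn_divLR // mulSn.
by rewrite addSn addnC ltnS leq_add2l.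
Qed.

Section ArrayCodes.

Variables (F : finFieldType) (n l : nat).
Implicit Types (C : array_code F n l) (i j : 'I_n) (H K : {set 'I_n}).

Definition MDS_array_code (k : nat) C : Prop :=
  \dim C = k * l /\
  forall K, #|K| = k ->
    forall x y : array_word F n l, x \in C -> y \in C ->
      (forall j, j \in K -> x j = y j) -> x = y.

(* The data [f j (x j)], j in H, determine the node x i of a codeword x; only
   the values of f on H matter. *)
Definition repairs C i H (m : nat) (f : 'I_n -> 'rV[F]_l -> 'rV[F]_m) : Prop :=
  forall x y : array_word F n l, x \in C -> y \in C ->
    (forall j, j \in H -> f j (x j) = f j (y j)) -> x i = y i.

Definition MSR_code (k d : nat) C : Prop :=
  let s := d - k + 1 in
  [/\ s %| l,
      MDS_array_code k C
    & forall i H, i \notin H -> #|H| = d ->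
        exists f : 'I_n -> 'rV[F]_l -> 'rV[F]_(l %/ s), repairs C i H f].

(* f v consists of m of the coordinates of v, at m distinct positions that do
   not depend on v. *)
Definition coordinate_selection (m : nat) (f : 'rV[F]_l -> 'rV[F]_m) : Prop :=
  exists2 a : 'I_m -> 'I_l, injective a & forall v, f v = colsub a v.

Definition optimal_access (k d : nat) C : Prop :=
  let s := d - k + 1 in
  forall i H, i \notin H -> #|H| = d ->
    exists2 f : 'I_n -> 'rV[F]_l -> 'rV[F]_(l %/ s),
      repairs C i H f & forall j, j \in H -> coordinate_selection (f j).

End ArrayCodes.

(* Main.v *)
Require Import Defs.
From HB Require Import structures.
From mathcomp Require Import all_boot all_order all_algebra.
From mathcomp Require Import ring zify.

(** Write r = n - k. The nodes are split into groups of size s, and the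
    coordinates are words a with one digit in [0, s) per group. A row of the
    parity check matrix is dual to a family (p_a) of polynomials of degree less
    than r: at coordinate a, the node i with position b in group g contributes
    e p_a(x), plus, when a_g <> b, the coupling - p_a'(x), where a' is a with
    a_g replaced by b and x = lam i a_g; all these points x are distinct. Any
    r nodes determine p as soon as this holds inside each group: the families
    killed by the nodes of one group form an F[X]-submodule with a monic matrix
    of generators, which acts on one digit only and hence commutes with the
    conditions of the other groups. The local conditions hold outside the
    eigenvalues e of O_s(1) matrices per group, so O_s(n) field elements suffice.
    Node i is repaired from the rows with a_g = b, where the other
    nodes are accessed only at the coordinates with a_g = b. *)

Set Implicit Arguments.
Unset Strict Implicit.
Unset Printing Implicit Defensive.

Import GRing.Theory.
Local Open Scope ring_scope.

(** * Submatrices with independent rows, and matrix pencils *)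

Section LeftInjective.

Variables (F : fieldType) (I K : finType).
Implicit Types (M : I -> K -> F) (R : {set I}) (Q : {set K}).

(** Independence of the rows in [R] restricted to the columns in [Q]. Vectors are functions
    vanishing off [R], so rows keep their structured indices. *)
Definition left_injective M R Q : Prop :=
  forall p : I -> F, (forall i, i \notin R -> p i = 0) ->
    (forall j, j \in Q -> \sum_i p i * M i j = 0) -> forall i, p i = 0.

Definition minor M R Q : 'M[F]_(#|R|, #|Q|) :=
  \matrix_(u, v) M (enum_val u) (enum_val v).

Definition extend R (w : 'rV[F]_#|R|) (i : I) : F :=
  \sum_(u | enum_val u == i) w 0 u.

Lemma extend_out R (w : 'rV[F]_#|R|) i : i \notin R -> extend w i = 0.
Proof.
by move=> iR; apply: big_pred0 => u; apply: contraNF iR => /eqP <-; apply: enum_valP.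
Qed.

Lemma extend_enum_val R (w : 'rV[F]_#|R|) u : extend w (enum_val u) = w 0 u.
Proof. by apply: big_pred1 => v; rewrite (inj_eq enum_val_inj). Qed.

Lemma sum_extend M R Q (w : 'rV[F]_#|R|) v :
  \sum_i extend w i * M i (enum_val v) = (w *m minor M R Q) 0 v.
Proof.
rewrite (bigID (mem R)) /= [X in _ + X]big1 ?addr0 => [|i iR]; last first.
  by rewrite extend_out ?mul0r.
rewrite big_enum_val mxE; apply: eq_bigr => u _.
by rewrite extend_enum_val mxE.
Qed.

Lemma left_injectiveP M R Q : left_injective M R Q <-> row_free (minor M R Q).
Proof.
split=> [inj | free p pR pQ i].
  apply: inj_row_free => w w0; apply/rowP => u.
  rewrite mxE -extend_enum_val; apply: inj => [i|j jQ]; first exact: extend_out.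
  by rewrite -(enum_rankK_in jQ jQ) sum_extend w0 mxE.
have [iR|/pR//] := boolP (i \in R).
pose w := \row_(u < #|R|) p (enum_val u).
have pE : extend w =1 p.
  move=> i'; have [i'R|i'R] := boolP (i' \in R); last by rewrite extend_out ?pR.
  by rewrite -(enum_rankK_in i'R i'R) extend_enum_val mxE.
suff w0 : w = 0 by rewrite -pE -(enum_rankK_in iR iR) extend_enum_val w0 mxE.
apply: (row_free_inj free); rewrite mul0mx; apply/rowP => v; rewrite [RHS]mxE.
rewrite -sum_extend -[RHS](pQ _ (enum_valP v)).
by apply: eq_bigr => i' _; rewrite pE.
Qed.

Lemma left_injective_surjective M R Q : #|R| = #|Q| -> left_injective M R Q ->
  forall y : K -> F, exists2 p : I -> F, forall i, i \notin R -> p i = 0 &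
    forall j, j \in Q -> \sum_i p i * M i j = y j.
Proof.
move=> RQ /left_injectiveP free y.
have full : row_full (minor M R Q) by rewrite /row_full (eqP free) RQ.
pose w := \row_(v < #|Q|) y (enum_val v) *m pinvmx (minor M R Q).
exists (extend w) => [i|j jQ]; first exact: extend_out.
rewrite -(enum_rankK_in jQ jQ) sum_extend mulmxKpV ?mxE //.
exact: submx_full.
Qed.

End LeftInjective.

(** Since [e *: A - B] equals [- (B *m invmx A - e%:M) *m A], the excluded [e] are the eigenvalues
    of [B *m invmx A], roots of a polynomial of degree [n]. *)
Lemma card_singular_pencil (F : finFieldType) n (A B : 'M[F]_n) :
  A \in unitmx -> (#|[set e | (e *: A - B)%R \notin unitmx]| <= n)%N.
Proof.
move=> Au; rewrite -ltnS -(size_char_poly (B *m invmx A)) cardE.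
apply: max_poly_roots; rewrite ?enum_uniq ?monic_neq0 ?char_poly_monic //.
apply/allP => e; rewrite mem_enum inE -eigenvalue_root_char; apply: contraR.
rewrite /eigenvalue negbK /eigenspace kermx_eq0 row_free_unit => BAu.
have -> : e *: A - B = - ((B *m invmx A - e%:M) *m A).
  by rewrite mulmxBl mulmxKV // mul_scalar_mx opprB.
by rewrite -scaleN1r unitmxZ ?unitrN1 // unitmx_mul BAu.
Qed.

Lemma left_injective_pencil (F : finFieldType) (I K : finType)
    (A B : I -> K -> F) (R : {set I}) (Q : {set K}) :
    #|R| = #|Q| -> left_injective A R Q ->
  exists2 bad : {set F}, (#|bad| <= #|R|)%N &
    forall e, e \notin bad -> left_injective (fun i j => e * A i j - B i j) R Q.
Proof.
move=> RQ /left_injectiveP Afree.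
(* Minors have type [#|R|] by [#|Q|]; the cast makes them square, so that [unitmx] applies. *)
pose c := castmx (erefl #|R|, esym RQ) : 'M[F]_(_, _) -> 'M[F]_(_, _).
have c_free X : row_free (c X) = row_free X.
  by rewrite /c; case: _ / (esym RQ) X => X; rewrite castmx_id.
exists [set e | e *: c (minor A R Q) - c (minor B R Q) \notin unitmx].
  by apply: card_singular_pencil; rewrite -row_free_unit c_free.
move=> e; rewrite inE negbK -row_free_unit => free; apply/left_injectiveP.
rewrite -c_free; congr (row_free _): free; apply/matrixP => i j.
by rewrite !(castmxE, mxE).
Qed.

(** * Coupled polynomial families *)

Section Coupling.

Variables (F : fieldType) (N G J : finType).
Variables (grp : N -> G) (pos : N -> J) (lam : N -> J -> F) (e : F).
Implicit Types (i : N) (g : G) (a : {ffun G -> J}) (B S : {set N}).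

Definition coupled_eval i (p : J -> {poly F}) (j : J) : F :=
  e * (p j).[lam i j] - (j != pos i)%:R * (p (pos i)).[lam i j].

(** A square system: [#|J| * #|B|] coefficients against one condition per node of [B] and digit. *)
Definition regular B : Prop :=
  forall p : J -> {poly F}, (forall j, size (p j) <= #|B|)%N ->
    (forall i j, i \in B -> coupled_eval i p j = 0) -> forall j, p j = 0.

Definition update a g j : {ffun G -> J} := [ffun h => if h == g then j else a h].

Lemma update_same a g j : update a g j g = j.
Proof. by rewrite ffunE eqxx. Qed.

Lemma update_other a g h j : h != g -> update a g j h = a h.
Proof. by rewrite ffunE => /negPf ->. Qed.

Lemma update_id a g : update a g (a g) = a.
Proof. by apply/ffunP => h; rewrite ffunE; case: eqP => // ->. Qed.

Lemma update_update a g j j' : update (update a g j) g j' = update a g j'.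
Proof. by apply/ffunP => h; rewrite !ffunE; case: eqP. Qed.

Lemma update_comm a g h j j' : g != h ->
  update (update a g j) h j' = update (update a h j') g j.
Proof.
move=> gh; apply/ffunP => x; rewrite !ffunE.
by case: (x =P h) => // ->; rewrite eq_sym (negPf gh).
Qed.

Definition global_eval i (p : {ffun G -> J} -> {poly F}) a : F :=
  coupled_eval i (fun j => p (update a (grp i) j)) (a (grp i)).

Lemma global_evalE i p a :
  global_eval i p a = e * (p a).[lam i (a (grp i))]
    - (a (grp i) != pos i)%:R *
      (p (update a (grp i) (pos i))).[lam i (a (grp i))].
Proof. by rewrite /global_eval /coupled_eval update_id. Qed.

Lemma eq_coupled_eval i p q j : p =1 q -> coupled_eval i p j = coupled_eval i q j.
Proof. by move=> pq; rewrite /coupled_eval !pq. Qed.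

Lemma coupled_eval_sum (K : finType) i (c : K -> {poly F}) (p : K -> J -> {poly F}) j :
  coupled_eval i (fun j' => \sum_k c k * p k j') j
  = \sum_k (c k).[lam i j] * coupled_eval i (p k) j.
Proof.
rewrite /coupled_eval !horner_sum !mulr_sumr -sumrB.
apply: eq_bigr => k _; rewrite !hornerM mulrBr; congr (_ - _); exact: mulrCA.
Qed.

Lemma coupled_evalB i p q j :
  coupled_eval i (fun j' => p j' - q j') j = coupled_eval i p j - coupled_eval i q j.
Proof. by rewrite /coupled_eval !hornerE; ring. Qed.

Lemma coupled_evalM i c p j :
  coupled_eval i (fun j' => c * p j') j = c.[lam i j] * coupled_eval i p j.
Proof. by rewrite /coupled_eval !hornerM mulrBr; congr (_ - _); exact: mulrCA. Qed.

(** The columns of [U] are families killed by [B], and [U] is ['X^#|B|] times the identity plus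
    terms of lower degree. *)
Definition monic_kernel_matrix B (U : J -> J -> {poly F}) : Prop :=
  (forall j j', size (U j j' - (j == j')%:R * 'X^#|B|)%R <= #|B|)%N /\
  (forall i j j', i \in B -> coupled_eval i (U^~ j') j = 0).

(** The dictionary between row combinations and polynomial evaluations. [A] is arbitrary because it
    serves both single digits and whole digit words. *)
Lemma sum_row_coef (A : finType) t (c : A * 'I_t -> F) (a1 a2 : A) (x f : F) :
  \sum_k c k * ((e * (k.1 == a1)%:R - f * (k.1 == a2)%:R) * x ^+ k.2)
  = e * (\sum_(u < t) c (a1, u) *: 'X^u).[x]
    - f * (\sum_(u < t) c (a2, u) *: 'X^u).[x].
Proof.
have row b : \sum_k c k * ((k.1 == b)%:R * x ^+ k.2)
           = (\sum_(u < t) c (b, u) *: 'X^u).[x].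
  transitivity (\sum_y \sum_(u < t) c (y, u) * ((y == b)%:R * x ^+ u)).
    by rewrite pair_bigA; apply: eq_bigr => -[].
  rewrite horner_sum.
  rewrite (bigD1 b) //= [X in _ + X]big1 ?addr0 => [|y /negPf yb]; last first.
    by rewrite big1 // => u _; rewrite yb mul0r mulr0.
  by apply: eq_bigr => u _; rewrite eqxx mul1r hornerZ hornerXn.
rewrite -!row !mulr_sumr -sumrB; apply: eq_bigr => k _; ring.
Qed.

Lemma size_sum_monomials t (c : 'I_t -> F) : (size (\sum_(u < t) c u *: 'X^u)%R <= t)%N.
Proof.
apply/(leq_trans (size_sum _ _ _))/bigmax_leqP => u _.
by rewrite (leq_trans (size_scale_leq _ _)) ?size_polyXn.
Qed.

Lemma sum_monomials_eq0 t (c : 'I_t -> F) :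
  \sum_(u < t) c u *: 'X^u = 0 -> forall u, c u = 0.
Proof.
move=> c0 u; have := congr1 (fun p : {poly F} => p`_u) c0.
rewrite coef_sum coef0 (bigD1 u) //= coefZ coefXn eqxx mulr1 big1 ?addr0 // => v vu.
by rewrite coefZ coefXn (eq_sym (u : nat)) (inj_eq val_inj) (negPf vu) mulr0.
Qed.

Lemma sum_monomials_coef t (p : {poly F}) : (size p <= t)%N ->
  \sum_(u < t) p`_u *: 'X^u = p.
Proof. by move=> pt; rewrite -poly_def -/(take_poly t p) take_poly_id. Qed.

Definition row_coef B (k : J * 'I_#|B|) (x : N * J) : F :=
  (e * (k.1 == x.2)%:R - (x.2 != pos x.1)%:R * (k.1 == pos x.1)%:R)
    * lam x.1 x.2 ^+ k.2.

Lemma sum_row_coefE B c (x : N * J) : \sum_k c k * row_coef (B := B) k x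
  = coupled_eval x.1 (fun j => \sum_(u < #|B|) c (j, u) *: 'X^u) x.2.
Proof. exact: sum_row_coef. Qed.

Lemma card_row_coef B : #|[set: J * 'I_#|B|]| = #|setX B [set: J]|.
Proof. by rewrite cardsT card_prod card_ord cardsX cardsT mulnC. Qed.

Lemma regularP B : regular B <->
  left_injective (row_coef (B := B)) setT (setX B setT).
Proof.
split=> [reg c _ c0 [j u] | inj p sz p0 j].
  apply: (sum_monomials_eq0 (c := fun u => c (j, u))); move: j {u}.
  apply: reg => [j|i j iB]; first exact: size_sum_monomials.
  by rewrite -(sum_row_coefE c (i, j)); apply: c0; rewrite !inE iB.
rewrite -(sum_monomials_coef (sz j)) big1 // => u _.
rewrite (inj (fun k => (p k.1)`_k.2) _ _ (j, u)) ?scale0r // => [k|[i j']].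
  by rewrite inE.
rewrite !inE andbT => iB; rewrite sum_row_coefE -[RHS](p0 i j' iB).
by apply: eq_coupled_eval => j0; rewrite /= sum_monomials_coef.
Qed.

(** A regular square system is also surjective, so the values of ['X^#|B|] placed at digit [j'] can
    be cancelled by a family of lower degree; the sum is column [j']. *)
Lemma monic_kernel_matrix_exists B : regular B -> exists U, monic_kernel_matrix B U.
Proof.
move=> /regularP inj.
have sol j' : exists L : J -> {poly F}, (forall j, size (L j) <= #|B|)%N /\
    forall i j, i \in B ->
      coupled_eval i L j = - coupled_eval i (fun j => (j == j')%:R * 'X^#|B|) j.
  have [p _ pE] := left_injective_surjective (card_row_coef B) inj
    (fun x => - coupled_eval x.1 (fun j => (j == j')%:R * 'X^#|B|) x.2).
  exists (fun j => \sum_(u < #|B|) p (j, u) *: 'X^u); split=> [j|i j iB].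
    exact: size_sum_monomials.
  by rewrite -(sum_row_coefE p (i, j)) pE // !inE iB.
have [L LP] := fin_all_exists sol.
exists (fun j j' => (j == j')%:R * 'X^#|B| + L j' j); split=> [j j'|i j j' iB].
  by rewrite addrAC subrr add0r; apply: (LP j').1.
transitivity (coupled_eval i (fun j => (j == j')%:R * 'X^#|B|) j
              + coupled_eval i (L j') j).
  by rewrite /coupled_eval !hornerD; ring.
by rewrite (LP j').2 // subrr.
Qed.

(** * The module of families killed by the nodes of one group *)

Section MonicKernelMatrix.

Variables (B : {set N}) (U : J -> J -> {poly F}).
Hypotheses (Breg : regular B) (UP : monic_kernel_matrix B U).

Lemma size_monic_row (v : J -> F) j :
  (size (\sum_j' (v j')%:P * U j j' - v j *: 'X^#|B|)%R <= #|B|)%N.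
Proof.
have -> : \sum_j' (v j')%:P * U j j' - v j *: 'X^#|B|
    = \sum_j' v j' *: (U j j' - (j == j')%:R * 'X^#|B|).
  under [RHS]eq_bigr do rewrite scalerBr -mul_polyC.
  rewrite sumrB; congr (_ - _); rewrite (bigD1 j) //= eqxx mul1r big1 ?addr0 //.
  by move=> j' /negPf; rewrite eq_sym => ->; rewrite mul0r scaler0.
apply/(leq_trans (size_sum _ _ _))/bigmax_leqP => j' _.
by rewrite (leq_trans (size_scale_leq _ _)) // UP.1.
Qed.

(** If [U] at [x] kills [v], then ['X - x%:P] divides [w], the product of [U] and [v]. The quotient
    has size at most [#|B|] and is still killed by [B], as [x] is none of its points, so regularity
    makes it zero. But [v] is the leading coefficient of [w]. *)
Lemma kernel_matrix_invertible (x : F) (v : J -> F) :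
    (forall i j, i \in B -> lam i j != x) ->
    (forall j, \sum_j' (U j j').[x] * v j' = 0) -> forall j, v j = 0.
Proof.
move=> xB Uv0; pose w j := \sum_j' (v j')%:P * U j j'.
have wx j : 'X - x%:P %| w j.
  rewrite dvdp_XsubCl /root /w horner_sum; apply/eqP; rewrite -[RHS](Uv0 j).
  by apply: eq_bigr => j' _; rewrite hornerM hornerC mulrC.
have wE j : w j = ('X - x%:P) * (w j %/ ('X - x%:P)).
  by rewrite mulrC divpK.
have w_size j : (size (w j) <= #|B|.+1)%N.
  rewrite -(subrK (v j *: 'X^#|B|) (w j)) (leq_trans (size_polyD _ _)) //.
  rewrite geq_max (leq_trans (size_monic_row v j)) //=.
  by rewrite (leq_trans (size_scale_leq _ _)) ?size_polyXn.
have w0 j : w j = 0.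
  rewrite wE [_ %/ _](Breg (p := fun j => w j %/ ('X - x%:P))) ?mulr0 // => {}j.
    by rewrite size_divp ?polyXsubC_eq0 // size_XsubC leq_subLR add1n.
  move=> j' iB; apply: (mulfI (x := lam j j' - x)); first by rewrite subr_eq0 xB.
  rewrite mulr0 -[lam _ _ - x]hornerXsubC -coupled_evalM.
  under eq_coupled_eval do rewrite -wE.
  by rewrite coupled_eval_sum big1 // => k _; rewrite UP.2 ?mulr0.
move=> j; have := size_monic_row v j; rewrite -/(w j) w0 sub0r size_polyN.
move/leq_sizeP/(_ _ (leqnn _)).
by rewrite coefZ coefXn eqxx mulr1.
Qed.

(** Division by the monic matrix [U], acting on digit [g]: every family killed by [B] lies in the
    image of [U], and the quotient is shorter by [#|B|]. *)
Lemma kernel_matrix_division g n (p : {ffun G -> J} -> {poly F}) :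
    (forall i, i \in B -> grp i = g) ->
    (forall a, size (p a) <= n + #|B|)%N ->
    (forall i a, i \in B -> global_eval i p a = 0) ->
  exists2 q : {ffun G -> J} -> {poly F}, (forall a, size (q a) <= n)%N &
    forall a, p a = \sum_j U (a g) j * q (update a g j).
Proof.
move=> Bg; elim: n p => [|n IHn] p p_size p0.
  (* What is left has size at most [#|B|] and is killed by [B], hence vanishes by regularity. *)
  exists (fun=> 0) => a; rewrite ?size_poly0 // big1 => [|j _]; last exact: mulr0.
  rewrite -(update_id a g); apply: (Breg (p := fun j => p (update a g j))) => // i j iB.
  by rewrite -[RHS](p0 i (update a g j) iB) /global_eval Bg // update_same;
     apply: eq_coupled_eval => j'; rewrite update_update.
pose c a := (p a)`_(n + #|B|).
(* As [U] is monic, this cancels the coefficient [c a] of degree [n + #|B|]; the subtracted family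
   is killed by [B] too. *)
pose p' a := p a - \sum_j U (a g) j * ((c (update a g j))%:P * 'X^n).
have [a||q q_size p'E] := IHn p'.
- have p'D : p' a = (p a - c a *: 'X^(n + #|B|))
      - 'X^n * (\sum_j (c (update a g j))%:P * U (a g) j - c a *: 'X^#|B|).
    rewrite /p' mulrBr mulr_sumr exprD -scalerAr opprB addrA subrK.
    by congr (_ - _); apply: eq_bigr => j _; ring.
  apply/leq_sizeP => u tu; rewrite p'D !coefB coefXnM coefZ coefXn.
  have := size_monic_row (fun j => c (update a g j)) (a g).
  rewrite update_id => /leq_sizeP ->; last by rewrite leq_subRL // (leq_trans (leq_addr _ _) tu).
  rewrite if_same subr0; move: tu; rewrite leq_eqVlt => /predU1P[<-|tu].
    by rewrite eqxx mulr1 subrr.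
  rewrite [_`_u](leq_sizeP _ _ (p_size a)) ?addSn // gtn_eqF //.
  by rewrite mulr0 subr0.
- move=> i a iB; rewrite /global_eval coupled_evalB -/(global_eval i p a) p0 // sub0r.
  rewrite Bg //.
  transitivity (- coupled_eval i (fun j => \sum_j0 ((c (update a g j0))%:P * 'X^n) * U j j0) (a g)).
    congr (- _); apply: eq_coupled_eval => j; rewrite update_same.
    by apply: eq_bigr => j0 _; rewrite update_update mulrC.
  by rewrite coupled_eval_sum big1 ?oppr0 // => j0 _; rewrite UP.2 ?mulr0.
exists (fun a => q a + (c a)%:P * 'X^n) => a.
  rewrite (leq_trans (size_polyD _ _)) // geq_max (leq_trans (q_size a)) //=.
  by rewrite mul_polyC (leq_trans (size_scale_leq _ _)) ?size_polyXn.
under eq_bigr do rewrite mulrDr.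
by rewrite big_split -p'E /p' /= subrK.
Qed.

End MonicKernelMatrix.

(** * From the groups to all nodes *)

Hypothesis lam_inj : forall i j i' j', lam i j = lam i' j' -> i = i' /\ j = j'.
Hypothesis fiber_regular :
  forall g B, (forall i, i \in B -> grp i = g) -> regular B.

(** Induction removing one group at a time: dividing by its matrix [U] shortens the family by the
    number of nodes removed, and the quotient inherits the conditions of the other nodes. *)
Lemma global_regular S (p : {ffun G -> J} -> {poly F}) :
    (forall a, size (p a) <= #|S|)%N ->
    (forall i a, i \in S -> global_eval i p a = 0) -> forall a, p a = 0.
Proof.
move: {2}#|S|.+1 (ltnSn #|S|) => n; elim: n S p => // n IHn S p Sn p_size p0 a.
have [S0|[i0 i0S]] := set_0Vmem S.
  by apply/eqP; rewrite -size_poly_leq0 (leq_trans (p_size a)) // S0 cards0.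
pose g := grp i0; pose B := [set i in S | grp i == g].
have Bg i : i \in B -> grp i = g by rewrite inE => /andP[_ /eqP].
have Breg := fiber_regular Bg.
have BS : B \subset S by apply/subsetP => i; rewrite inE => /andP[].
have [U UP] := monic_kernel_matrix_exists Breg.
have cardS : #|S| = (#|S :\: B| + #|B|)%N.
  by rewrite -(cardsID B S) (setIidPr BS) addnC.
have [||q q_size pE] := kernel_matrix_division (n := #|S :\: B|) Breg UP Bg (p := p).
- by move=> a'; rewrite -cardS.
- by move=> i a' iB; apply: p0; apply: (subsetP BS).
rewrite pE big1 // => j _; rewrite (IHn (S :\: B) q) ?mulr0 //.
  rewrite -(ltn_add2r #|B|) -cardS (leq_trans Sn) // -addn1 leq_add2l.
  by rewrite card_gt0; apply/set0Pn; exists i0; rewrite inE i0S eqxx.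
move=> i a'; rewrite !inE negb_and => /andP[/orP[/negP//|ig] iS].
(* The matrix U acts on the digit g and node i on the digit grp i, so the two
   commute: U, evaluated at a point where it is invertible, intertwines the
   values of q and p. *)
pose b j' := update a' g j'.
suff: forall j', global_eval i q (b j') = 0 by move/(_ (a' g)); rewrite /b update_id.
apply: (kernel_matrix_invertible Breg UP (x := lam i (a' (grp i)))) => [i' j1 i'B|j1].
  apply: contraNneq ig => /lam_inj[<- _]; apply/eqP; exact: Bg.
have gi : g != grp i by rewrite eq_sym.
have pb : p (b j1) = \sum_j2 U j1 j2 * q (b j2).
  by rewrite pE update_same; apply: eq_bigr => j2 _; rewrite update_update.
have pbu j' : p (update (b j1) (grp i) j')
            = \sum_j2 U j1 j2 * q (update (b j2) (grp i) j').
  rewrite pE update_other // update_same; apply: eq_bigr => j2 _.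
  by rewrite /b !(update_comm _ _ _ gi) update_update.
have bi j' : b j' (grp i) = a' (grp i) by rewrite update_other // eq_sym.
rewrite -[RHS](p0 i (b j1) iS) global_evalE pb pbu bi !horner_sum !mulr_sumr -sumrB.
by apply: eq_bigr => j2 _; rewrite global_evalE bi !hornerM; ring.
Qed.

(** Dividing out the prescribed roots lowers the size by [#|X|]. Their product [m] is nonzero at the
    points of [S], so the quotient keeps the coupled conditions. *)
Lemma global_regular_roots S (X : {set N * J}) (p : {ffun G -> J} -> {poly F}) :
    (forall x, x \in X -> x.1 \notin S) ->
    (forall a, size (p a) <= #|X| + #|S|)%N ->
    (forall x a, x \in X -> root (p a) (lam x.1 x.2)) ->
    (forall i a, i \in S -> global_eval i p a = 0) ->
  forall a, p a = 0.
Proof.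
move=> XS p_size pX p0; pose lamX := [seq lam x.1 x.2 | x <- enum X].
pose m := \prod_(z <- lamX) ('X - z%:P).
have m_neq0 : m != 0 by apply: monic_neq0; apply: monic_prod_XsubC.
have pE a : p a = m * (p a %/ m).
  rewrite mulrC divpK // uniq_roots_dvdp // ?uniq_rootsE.
    by apply/allP => _ /mapP[x xX ->]; apply: pX; rewrite -mem_enum.
  rewrite map_inj_uniq ?enum_uniq //.
  by move=> [i j] [i' j'] /= /lam_inj[-> ->].
move=> a; rewrite pE [_ %/ _](@global_regular S (fun a => p a %/ m)) ?mulr0 //.
  move=> a'; rewrite size_divp // size_prod_XsubC size_map -cardE.
  by rewrite leq_subLR.
move=> i a' iS; apply: (mulfI (x := m.[lam i (a' (grp i))])); last first.
  rewrite mulr0 /global_eval -coupled_evalM -[RHS](p0 i a' iS).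
  by apply: eq_coupled_eval => j; rewrite -pE.
rewrite -[_ == _]/(root m _) root_prod_XsubC; apply/mapP => -[x].
by rewrite mem_enum => /XS xS /lam_inj[iE _]; rewrite -iE iS in xS.
Qed.

End Coupling.

(** * The parity check matrix *)

(** The system is a pencil in [e]. Its leading part [A] is uncoupled: it evaluates each polynomial,
    of size at most [#|B|], at [#|B|] distinct points, hence is injective. *)
Lemma generic_regular (F : finFieldType) (N J : finType) (pos : N -> J)
    (lam : N -> J -> F) (B : {set N}) :
    (forall i i' j, lam i j = lam i' j -> i = i') ->
  exists2 bad : {set F}, (#|bad| <= #|J| * #|B|)%N &
    forall e, e \notin bad -> regular pos lam e B.
Proof.
move=> lam_inj.
(* The factors 1 and 0 give [A] the shape expected by [sum_row_coef]. *)
pose A (k : J * 'I_#|B|) x := (1 * (k.1 == x.2)%:R - 0 * (k.1 == x.2)%:R)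
  * lam x.1 x.2 ^+ k.2.
pose C (k : J * 'I_#|B|) (x : N * J) := (x.2 != pos x.1)%:R
  * (k.1 == pos x.1)%:R * lam x.1 x.2 ^+ k.2.
have Ainj : left_injective A setT (setX B setT).
  move=> c _ c0 [j u].
  apply: (sum_monomials_eq0 (c := fun u => c (j, u))).
  set p := (X in X = 0); apply/eqP; apply: contraTT isT => p0.
  have := @max_poly_roots _ p [seq lam i j | i <- enum B] p0.
  rewrite size_map -cardE ltnNge size_sum_monomials => -> //.
    apply/allP => _ /mapP[i iB ->]; rewrite mem_enum in iB; apply/eqP.
    rewrite -[RHS](c0 (i, j)) ?inE ?iB // (sum_row_coef _ _ j j).
    by rewrite mul1r mul0r subr0.
  by rewrite map_inj_uniq ?enum_uniq // => i i'; apply: lam_inj.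
have [bad bad_size badP] := left_injective_pencil C (card_row_coef J B) Ainj.
exists bad; first by rewrite cardsT card_prod card_ord in bad_size.
move=> e /badP inj; apply/regularP => c cR cQ; apply: inj => // x xQ.
rewrite -[RHS](cQ x xQ); apply: eq_bigr => k _.
by rewrite /A /C /row_coef; ring.
Qed.

Lemma card_bigcup_leq (I T : finType) (A : I -> {set T}) b :
  (forall i, #|A i| <= b)%N -> (#|\bigcup_i A i| <= #|I| * b)%N.
Proof.
move=> Ab; apply: (@leq_trans (\sum_(i : I) b)%N); last by rewrite sum_nat_const.
apply: (big_ind2 (fun (X : {set T}) m => #|X| <= m)%N) => // [|X m Y m' Xm Ym].
  by rewrite cards0.
by rewrite (leq_trans (leq_card_setU X Y)) ?leq_add.
Qed.

(** Union bound: a set of nodes within a group is given by the group and a set of positions, and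
    each such pair excludes at most [#|J| * #|J|] values of [e]; one more is lost to [e != 0]. *)
Lemma exists_coupling (F : finFieldType) (N G J : finType)
    (grp : N -> G) (pos : N -> J) (lam : N -> J -> F) :
    (forall i i', grp i = grp i' -> pos i = pos i' -> i = i') ->
    (forall i i' j, lam i j = lam i' j -> i = i') ->
    (#|G| * (2 ^ #|J| * (#|J| * #|J|)) + 1 < #|F|)%N ->
  exists2 e : F, e != 0 &
    forall g (B : {set N}), (forall i, i \in B -> grp i = g) -> regular pos lam e B.
Proof.
move=> node_inj lam_inj F_large.
pose part (x : G * {set J}) := [set i | (grp i == x.1) && (pos i \in x.2)].
have bad x : exists bad : {set F}, (#|bad| <= #|J| * #|J|)%N /\
    forall e, e \notin bad -> regular pos lam e (part x).
  have [bad bad_size badP] := generic_regular pos (part x) lam_inj.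
  exists bad; split=> //; rewrite (leq_trans bad_size) // leq_mul2l; apply/orP; right.
  rewrite -(card_in_imset (f := pos)) ?max_card // => i i'.
  by rewrite !inE => /andP[/eqP gi _] /andP[/eqP gi' _]; apply: node_inj; rewrite gi.
have [f fP] := fin_all_exists bad.
have : (#|0%R |: \bigcup_x f x| < #|F|)%N.
  apply: leq_ltn_trans F_large; rewrite cardsU1 addnC leq_add ?leq_b1 //.
  have <- : #|{set J}| = (2 ^ #|J|)%N.
    by rewrite -[in RHS]cardsT -card_powerset powersetT cardsT.
  by rewrite mulnA -(card_prod G); apply: card_bigcup_leq (fun x => (fP x).1).
rewrite ltnNge => /negP small.
have [e eP] : exists e, e \notin 0 |: \bigcup_x f x.
  apply/existsP; apply: contra_notT small; rewrite negb_exists => /forallP all_in.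
  by apply/subset_leq_card/subsetP => x _; rewrite -[_ \in _]negbK.
move: eP; rewrite !inE negb_or => /andP[e_neq0 e_good]; exists e => // g B Bg.
have -> : B = part (g, pos @: B).
  apply/setP => i; rewrite !inE /=; apply/idP/andP => [iB|[/eqP ig /imsetP[i' i'B ii']]].
    by rewrite imset_f // Bg.
  by rewrite (node_inj i i') // ig Bg.
by apply: (fP _).2; apply: contraNN e_good => e_bad; apply/bigcupP; exists (g, pos @: B).
Qed.

Section ParityCheck.

Variables (F : finFieldType) (N G J : finType).
Variables (grp : N -> G) (pos : N -> J) (lam : N -> J -> F) (e : F).
Hypothesis node_inj : forall i i', grp i = grp i' -> pos i = pos i' -> i = i'.
Hypothesis lam_inj : forall i j i' j', lam i j = lam i' j' -> i = i' /\ j = j'.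
Hypothesis e_neq0 : e != 0.
Hypothesis fiber_regular :
  forall g (B : {set N}), (forall i, i \in B -> grp i = g) -> regular pos lam e B.
Implicit Types (i : N) (a : {ffun G -> J}).

Definition parity r (k : {ffun G -> J} * 'I_r) (x : N * {ffun G -> J}) : F :=
  (e * (k.1 == x.2)%:R - (x.2 (grp x.1) != pos x.1)%:R
     * (k.1 == update x.2 (grp x.1) (pos x.1))%:R) * lam x.1 (x.2 (grp x.1)) ^+ k.2.

Lemma sum_parity r (c : {ffun G -> J} * 'I_r -> F) x : \sum_k c k * parity k x
  = global_eval grp pos lam e x.1 (fun a => \sum_(u < r) c (a, u) *: 'X^u) x.2.
Proof. by rewrite global_evalE; apply: sum_row_coef. Qed.

(** The MDS property: any [#|S|] nodes give an invertible block of the parity check matrix. *)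
Lemma parity_left_injective (S : {set N}) :
  left_injective (parity (r := #|S|)) setT (setX S setT).
Proof.
move=> c _ c0 [a u]; apply: (sum_monomials_eq0 (c := fun u => c (a, u))).
move: a {u}; apply: (global_regular lam_inj fiber_regular (S := S)) => [a|i a iS].
  exact: size_sum_monomials.
by rewrite -(sum_parity c (i, a)); apply: c0; rewrite !inE iS.
Qed.

(** * Repair of the node [i0]; [U] is the set of nodes that neither fail nor help *)

Section Repair.

Variables (i0 : N) (U : {set N}) (r : nat).
Hypotheses (i0U : i0 \notin U) (rU : r = (#|J| + #|U|)%N).

Definition accessed : {set {ffun G -> J}} := [set a : {ffun G -> J} | a (grp i0) == pos i0].

Definition repair_rows : {set {ffun G -> J} * 'I_r} := setX accessed setT.

(** The unknowns of the repair equations: the whole failed node, and the accessed coordinates of the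
    nodes in [U]. *)
Definition repair_columns : {set N * {ffun G -> J}} :=
  setX [set i0] setT :|: setX U accessed.

Lemma card_accessed : #|{ffun G -> J}| = (#|J| * #|accessed|)%N.
Proof.
have -> : (#|J| * #|accessed|)%N = #|setX accessed [set: J]|.
  by rewrite cardsX cardsT mulnC.
rewrite -cardsT.
rewrite -(card_in_imset (f := fun x : _ * J => update x.1 (grp i0) x.2)).
  congr #|pred_of_set _|; apply/esym/setP => a; rewrite inE; apply/imsetP.
  exists (update a (grp i0) (pos i0), a (grp i0)); first by rewrite !inE update_same eqxx.
  by rewrite update_update update_id.
move=> [a j] [a' j']; rewrite !inE !andbT /= => /eqP ai /eqP ai' aa'.
have := congr1 (fun b : {ffun _ -> _} => b (grp i0)) aa'; rewrite !update_same => <-.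
have := congr1 (fun b => update b (grp i0) (pos i0)) aa'.
by rewrite !update_update -{1}ai -ai' !update_id => ->.
Qed.

Lemma card_repair : #|repair_rows| = #|repair_columns|.
Proof.
rewrite /repair_columns cardsU !cardsX !cardsT cards1 card_ord mul1n card_accessed.
rewrite (_ : _ :&: _ = set0) ?cards0 ?subn0 ?rU ?mulnDr ?mulnDl; last first.
  apply/setP => -[i a]; rewrite !inE /=.
  by case: (i =P i0) => //= ->; rewrite (negPf i0U).
by rewrite mulnC [(#|U| * _)%N]mulnC.
Qed.

(** The degrees balance: [#|J|] roots come from [i0], one from each node of [U] in its group, and
    one coupled condition from each other node of [U], in total [r]. *)
Lemma repair_left_injective : left_injective (parity (r := r)) repair_rows repair_columns.
Proof.
move=> c cR c0 [a u].
pose p (a : {ffun G -> J}) := \sum_(u < r) c (a, u) *: 'X^u.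
have p_out (b : {ffun G -> J}) : b (grp i0) != pos i0 -> p b = 0.
  by move=> bi; rewrite /p big1 // => v _; rewrite cR ?scale0r // !inE (negPf bi).
have eval0 i b : (i, b) \in repair_columns -> global_eval grp pos lam e i p b = 0.
  by move=> ib; rewrite -[RHS](c0 _ ib) sum_parity.
apply: (sum_monomials_eq0 (c := fun u => c (a, u))); rewrite -/(p a).
have [ai|] := eqVneq (a (grp i0)) (pos i0); last exact: p_out.
(* On the rows read by the repair, the nodes of the group of i0 only impose
   plain zeros: all the lam i0 j, and lam i (pos i0) for the other ones. *)
pose X := setX [set i0] setT :|: setX [set i in U | grp i == grp i0] [set pos i0].
pose S := [set i in U | grp i != grp i0].
(* [p] vanishes off the accessed words; [p'] extends its accessed values to all words, independently
   of the digit of [i0], which other groups leave untouched. *)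
pose p' b := p (update b (grp i0) (pos i0)).
rewrite -(update_id a (grp i0)) ai; move: a {u ai}.
apply: (global_regular_roots lam_inj fiber_regular (S := S) (X := X) (p := p')).
- move=> [i j]; rewrite !inE /= => /orP[/andP[/eqP-> _]|/andP[/andP[_ ->]]].
    by rewrite eqxx andbF.
  by rewrite andbF.
- move=> a; rewrite (leq_trans (size_sum_monomials _)) // rU.
  rewrite cardsU !cardsX cardsT !cards1 mul1n muln1.
  rewrite (_ : _ :&: _ = set0) ?cards0 ?subn0; last first.
    apply/setP => -[i j]; rewrite !inE /=.
    by case: (i =P i0) => //= ->; rewrite (negPf i0U).
  rewrite -addnA leq_add2l -(cardsID [set i | grp i == grp i0] U) leq_add //;
    by apply/subset_leq_card/subsetP => i; rewrite !inE // andbC.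
- have e_root q x : e * q.[x] = 0 -> root q x.
    by move/eqP; rewrite mulf_eq0 (negPf e_neq0).
  move=> [i j] a; rewrite !inE /= andbT => /orP[/eqP->|/andP[/andP[iU /eqP ig] /eqP->]].
    have [->|jpos] := eqVneq j (pos i0).
      have := eval0 i0 (update a (grp i0) (pos i0)).
      rewrite global_evalE !inE !eqxx update_same eqxx mul0r subr0 => /(_ isT).
      exact: e_root.
    (* The word with digit [j] is not accessed, so only the coupling term survives. *)
    have := eval0 i0 (update a (grp i0) j).
    rewrite global_evalE !inE !eqxx update_same jpos mul1r update_update.
    rewrite (p_out (update _ _ j)) ?update_same // horner0 mulr0 sub0r => /(_ isT)/eqP.
    by rewrite oppr_eq0.
  have pos_i : pos i != pos i0.
    by apply: contraNneq i0U => /node_inj <-.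
  have := eval0 i (update a (grp i0) (pos i0)).
  rewrite global_evalE !inE iU ig update_same eqxx orbT update_update.
  rewrite (p_out (update _ _ (pos i))) ?update_same // horner0 mulr0 subr0 => /(_ isT).
  exact: e_root.
move=> i a; rewrite inE => /andP[iU ig].
have := eval0 i (update a (grp i0) (pos i0)).
rewrite !inE iU update_same eqxx orbT !global_evalE update_other // => /(_ isT) <-.
by rewrite /p' (update_comm _ _ _ (g := grp i0)) // eq_sym.
Qed.

(** The coupling partner of [a] is not accessed either: in the group of [i0] its digit becomes
    [pos i], different from [pos i0]; in another group the digit at [grp i0] is unchanged. *)
Lemma parity_helper t i a : t \in repair_rows -> i != i0 -> a \notin accessed ->
  parity t (i, a) = 0.
Proof.
rewrite !inE andbT => /eqP t_acc ii0 ai; rewrite /parity /=.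
have -> : (t.1 == a) = false by apply: contraNF ai => /eqP <-; apply/eqP.
suff -> : (t.1 == update a (grp i) (pos i)) = false by rewrite !mulr0 subrr mul0r.
apply: contraNF ai => /eqP ta; have [ig|ig] := eqVneq (grp i0) (grp i).
  case/eqP: ii0; apply: node_inj; first exact: esym.
  by rewrite -t_acc ta ig update_same.
by rewrite -t_acc ta update_other.
Qed.

End Repair.

End ParityCheck.

(** * The code *)

(** Rank-nullity gives the lower bound on the dimension; [dim_determined] supplies the matching
    upper bound. *)
Lemma code_of_checks (F : fieldType) (I K : finType) n l
    (h : I -> K -> F) (node : K -> 'I_n) (coord : K -> 'I_l) :
  exists2 C : array_code F n l, (n * l <= \dim C + #|I|)%N &
    forall x : array_word F n l,
      x \in C <-> forall i, \sum_k h i k * x (node k) 0 (coord k) = 0.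
Proof.
pose f (x : array_word F n l) : 'rV[F]_#|I| :=
  \row_u \sum_k h (enum_val u) k * x (node k) 0 (coord k).
have f_linear : linear f.
  move=> b x y; apply/rowP => u; rewrite !mxE mulr_sumr -big_split.
  by apply: eq_bigr => k _; rewrite !ffunE !mxE /=; ring.
pose fl : {linear _ -> _} := HB.pack f (GRing.isLinear.Build _ _ _ _ f f_linear).
exists (lker (linfun fl)) => [|x].
  have := limg_ker_dim (linfun fl) fullv; rewrite capfv dimvf => dim_eq.
  have -> : (n * l)%N = dim (array_word F n l).
    by rewrite -[RHS]/(#|'I_n| * dim 'rV[F]_l)%N card_ord dim_matrix mul1r.
  rewrite -dim_eq leq_add2l (leq_trans (dimvS (subvf _))) // dimvf.
  by rewrite dim_matrix mul1r.
rewrite memv_ker lfunE /=; split=> [/eqP fx i | x0].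
  by have /rowP/(_ (enum_rank i)) := fx; rewrite !mxE enum_rankK.
by apply/eqP/rowP => u; rewrite !mxE x0.
Qed.

Lemma dim_determined (F : fieldType) n l (C : array_code F n l) (K : {set 'I_n}) :
    (forall x : array_word F n l, x \in C -> (forall j, j \in K -> x j = 0) -> x = 0) ->
  (\dim C <= #|K| * l)%N.
Proof.
move=> det.
pose f (x : array_word F n l) : 'M[F]_(#|K|, l) := \matrix_(u, c) x (enum_val u) 0 c.
have f_linear : linear f.
  by move=> b x y; apply/matrixP => u c; rewrite !mxE !ffunE !mxE.
pose fl : {linear _ -> _} := HB.pack f (GRing.isLinear.Build _ _ _ _ f f_linear).
rewrite -(limg_dim_eq (f := linfun fl)); last first.
  apply/eqP; rewrite -subv0; apply/subvP => x; rewrite memv_cap memv_ker lfunE /=.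
  move=> /andP[xC /eqP fx]; rewrite memv0; apply/eqP/det => // j jK.
  apply/rowP => c; have /matrixP/(_ (enum_rank_in jK j) c) := fx.
  by rewrite !mxE enum_rankK_in.
by rewrite (leq_trans (dimvS (subvf _))) // dimvf dim_matrix.
Qed.

Lemma exists_injection (A B : finType) : (#|A| <= #|B|)%N ->
  exists f : A -> B, injective f.
Proof.
move=> AB; exists (fun x => enum_val (widen_ord AB (enum_rank x))) => x y.
by move=> /enum_val_inj/(congr1 val) xy; apply/enum_rank_inj/val_inj.
Qed.

Section Code.

Variables (F : finFieldType) (n m s : nat) (lam : 'I_n -> 'I_s -> F) (e : F).
Hypotheses (s_gt0 : (0 < s)%N) (nms : (n <= m * s)%N).

Lemma group_ltn (i : 'I_n) : (i %/ s < m)%N.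
Proof. by rewrite ltn_divLR // (leq_trans (ltn_ord i)). Qed.

Definition group_of (i : 'I_n) : 'I_m := Ordinal (group_ltn i).
Definition position_of (i : 'I_n) : 'I_s := Ordinal (ltn_pmod i s_gt0).

Lemma node_of_inj i i' :
  group_of i = group_of i' -> position_of i = position_of i' -> i = i'.
Proof.
move=> /(congr1 val)/= gi /(congr1 val)/= pi; apply: val_inj.
by rewrite /= (divn_eq i s) gi pi -divn_eq.
Qed.

Hypothesis lam_inj : forall i j i' j', lam i j = lam i' j' -> i = i' /\ j = j'.
Hypothesis e_neq0 : e != 0.
Hypothesis fiber_regular : forall g (B : {set 'I_n}),
  (forall i, i \in B -> group_of i = g) -> regular position_of lam e B.

Let T := {ffun 'I_m -> 'I_s}.

Lemma card_digits : #|T| = (s ^ m)%N.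
Proof. by rewrite card_ffun !card_ord. Qed.

Definition coord (a : T) : 'I_(s ^ m) := cast_ord card_digits (enum_rank a).

Lemma coord_inj : injective coord.
Proof. by move=> a b /cast_ord_inj/enum_rank_inj. Qed.

Lemma coord_surj c : exists a, coord a = c.
Proof.
by exists (enum_val (cast_ord (esym card_digits) c)); rewrite /coord enum_valK cast_ordKV.
Qed.

Variables k d : nat.
Hypotheses (m_gt0 : (0 < m)%N) (kd : (k < d)%N) (dn : (d <= n - 1)%N).
Hypothesis sE : s = (d - k + 1)%N.

Notation check := (parity group_of position_of lam e (r := n - k)).

Lemma MSR_code_exists : exists C : array_code F n (s ^ m),
  MSR_code k d C /\ optimal_access k d C.
Proof.
have [C C_dim CP] := code_of_checks check fst (fun x => coord x.2).
have annihilate (x : array_word F n (s ^ m)) (c : T * 'I_(n - k) -> F) : x \in C ->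
    \sum_y (\sum_t c t * check t y) * x y.1 0 (coord y.2) = 0.
  move=> /CP x0; under eq_bigr do rewrite mulr_suml.
  rewrite exchange_big big1 //= => t _.
  transitivity (c t * \sum_y check t y * x y.1 0 (coord y.2)); last by rewrite x0 mulr0.
  by rewrite mulr_sumr; apply: eq_bigr => y _; rewrite mulrA.
(* Common to decoding and repair: an invertible block [R] by [Q] yields a combination of checks
   equal on [Q] to the indicator of [y], which isolates the entry at [y]. *)
have vanish (x : array_word F n (s ^ m)) (R : {set T * 'I_(n - k)}) (Q : {set 'I_n * T}) : x \in C -> #|R| = #|Q| ->
    left_injective check R Q ->
    (forall c, (forall t, t \notin R -> c t = 0) -> forall y, y \notin Q ->
      (\sum_t c t * check t y) * x y.1 0 (coord y.2) = 0) ->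
    forall y, y \in Q -> x y.1 0 (coord y.2) = 0.
  move=> xC RQ inj out y yQ.
  have [c cR cQ] := left_injective_surjective RQ inj (fun y' => (y' == y)%:R).
  rewrite -[RHS](annihilate x c xC) (bigID (mem Q)) /=.
  rewrite [X in _ = _ + X]big1 ?addr0 => [|y' y'Q]; last exact: out.
  rewrite (bigD1 y) //= cQ // eqxx mul1r big1 ?addr0 // => y' /andP[y'Q /negPf y'y].
  by rewrite cQ // y'y mul0r.
have det (K : {set 'I_n}) : #|K| = k -> forall x : array_word F n (s ^ m),
    x \in C -> (forall j, j \in K -> x j = 0) -> x = 0.
  move=> Kk x xC xK; have KC : #|~: K| = (n - k)%N by rewrite cardsCs setCK card_ord Kk.
  apply/ffunP => i; rewrite ffunE; have [/xK//|iK] := boolP (i \in K).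
  apply/rowP => c; rewrite mxE; have [a <-] := coord_surj c.
  have := parity_left_injective lam_inj fiber_regular (S := ~: K); rewrite KC => inj.
  apply: (vanish x _ _ xC _ inj _ (i, a)); last by rewrite !inE iK.
    by rewrite cardsX !cardsT card_prod KC card_ord mulnC.
  by move=> c' _ [i' a']; rewrite !inE andbT negbK => /xK ->; rewrite mxE mulr0.
have C_MDS : MDS_array_code k C.
  split=> [|K Kk x y xC yC xy].
    apply/eqP; rewrite eqn_leq; apply/andP; split.
      have [K Kk] : exists K : {set 'I_n}, #|K| = k.
        have kn : (k <= n)%N by lia.
        exists [set widen_ord kn u | u : 'I_k].
        by rewrite card_imset ?card_ord // => u v /(congr1 val) uv; apply: val_inj.
      by rewrite -Kk; apply: dim_determined (det K Kk).
    have nE : (n * s ^ m = k * s ^ m + (n - k) * s ^ m)%N.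
      by rewrite -mulnDl subnKC //; lia.
    move: C_dim; rewrite card_prod card_digits card_ord nE.
    by rewrite [(s ^ m * _)%N]mulnC leq_add2r.
  apply/eqP; rewrite -subr_eq0; apply/eqP/(det K Kk); first exact: rpredB.
  by move=> j /xy xyj; rewrite !ffunE xyj subrr.
have T_dvd : (s %| s ^ m)%N by rewrite -{1}(expn1 s) dvdn_exp2l.
have C_access : optimal_access k d C.
  move=> i0 H i0H Hd; rewrite -sE.
  have acc_card : (s ^ m %/ s)%N = #|accessed group_of position_of i0|.
    by rewrite -card_digits (card_accessed group_of position_of i0) card_ord mulKn.
  pose sel u := coord (enum_val (cast_ord acc_card u)).
  exists (fun _ v => colsub sel v) => [x y xC yC xy|j _]; last first.
    by exists sel => // u v /coord_inj/enum_val_inj/cast_ord_inj.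
  pose U := ~: (i0 |: H).
  have i0U : i0 \notin U by rewrite !inE eqxx.
  have rU : (n - k = #|'I_s| + #|U|)%N.
    by rewrite cardsCs setCK cardsU1 i0H Hd !card_ord sE; lia.
  have zH j a : j \in H -> a \in accessed group_of position_of i0 ->
      (x - y) j 0 (coord a) = 0.
    move=> /xy/rowP xyj aacc.
    have := xyj (cast_ord (esym acc_card) (enum_rank_in aacc a)).
    by rewrite !mxE /sel cast_ordKV enum_rankK_in // !ffunE !mxE => ->; rewrite subrr.
  apply/eqP; rewrite -subr_eq0; apply/eqP/rowP => c; have [a <-] := coord_surj c.
  have zQ := vanish (x - y) _ _ (rpredB xC yC) (card_repair group_of position_of i0U rU)
    (repair_left_injective node_of_inj lam_inj e_neq0 fiber_regular i0U rU).
  have := zQ _ (i0, a); rewrite !ffunE !mxE !inE eqxx => -> // {zQ}.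
  (* A column outside the unknowns is either a helper at an accessed coordinate, where [x - y]
     vanishes, or a node other than [i0] at a coordinate not accessed, where the repair rows
     vanish. *)
  move=> c' c'R [j b] yQ.
  have ji0 : j != i0 by apply: contraNneq yQ => ->; rewrite !inE eqxx.
  have [bacc|bacc] := boolP (b \in accessed group_of position_of i0).
    rewrite /= zH ?mulr0 //; apply: contraNT yQ => jH.
    by rewrite in_setU !in_setX bacc !inE (negPf ji0) jH.
  rewrite big1 ?mul0r // => t _.
  have [tR|/c'R->] := boolP (t \in repair_rows group_of position_of i0 (n - k)).
    by rewrite (parity_helper lam e node_of_inj tR) ?mulr0.
  by rewrite mul0r.
exists C; split=> //; split; rewrite -?sE // => i0 H i0H Hd.
by have [f Cf _] := C_access i0 H i0H Hd; rewrite -sE in f Cf *; exists f.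
Qed.
End Code.

Local Close Scope ring_scope.

Theorem mainTheorem1 (s : nat) :
  exists c : nat,
    forall n k d : nat, 1 <= k -> k < d -> d <= n - 1 -> s = d - k + 1 ->
    forall F : finFieldType, c * n <= #|F| ->
    exists C : array_code F n (s ^ ceil_div n s),
      MSR_code k d C /\ optimal_access k d C.
Proof.
(* As [m <= n], the first term pays for the excluded values of [e]; [s] provides [n * s] distinct
   points [lam], and 2 absorbs the strict bound with its extra 1. *)
exists (2 ^ s * (s * s) + s + 2) => n k d k_gt0 kd dn sE F F_large.
have s_gt0 : 0 < s by lia.
have n_gt0 : 0 < n by lia.
set m := ceil_div n s.
have nms : n <= m * s by rewrite -ceil_div_leq.
have mn : m <= n by rewrite ceil_div_leq // leq_pmulr.
have m_gt0 : 0 < m by move: nms; case: (m) => //; lia.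
have [|lam lam_inj] := @exists_injection ('I_n * 'I_s)%type F.
  by rewrite card_prod !card_ord mulnC (leq_trans _ F_large) // leq_mul2r; lia.
have lam_inj2 i j i' j' : lam (i, j) = lam (i', j') -> i = i' /\ j = j'.
  by move=> /lam_inj[-> ->].
have lam_inj1 i i' j : lam (i, j) = lam (i', j) -> i = i' by case/lam_inj2.
have [|e e_neq0 reg] := @exists_coupling F _ _ _ _ _ (fun i j => lam (i, j))
  (@node_of_inj n m s s_gt0 nms) lam_inj1.
  rewrite !card_ord; move: (2 ^ s * (s * s)) F_large => w F_large.
  by have := leq_mul mn (leqnn w); nia.
exact (MSR_code_exists lam_inj2 e_neq0 reg m_gt0 kd dn sE).
Qed.
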